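(* The partially locally constant Gromov--Hausdorff distance, the partially continuous Gromov--Hausdorff distance and the Gromov--Hausdorff distance coincide on the class of Gromov metric triples: for any Gromov metric triples $X=(X,d_X,\mu_X)$ and $Y=(Y,d_Y,\mu_Y)$, $$d_{GH}^{aec}(X,Y)=d_{GH}^{aeconst}(X,Y)=d_{GH}(X,Y).$$
   Context: A Gromov metric triple $(X,d,\mu)$ consists of a metric space $(X,d)$ and a Borel measure $\mu$ on $X$ that is boundedly finite (every ball, equivalently every bounded set, has finite measure). The Gromov--Hausdorff distance $d_{GH}$ between two triples is the classical Gromov--Hausdorff distance between the underlying metric spaces (values in $[0,\infty]$), i.e. the infimum over all isometric embeddings of the two spaces into a common metric space of the Hausdorff distance between the images. A map $f:(X,d_X,\mu_X)\to(Y,d_Y,\mu_Y)$ is called a.e. locally constant (respectively a.e. continuous) if there is a subset $U\subset\operatorname{supp}(\mu_X)$, open in the topology induced on the support $\operatorname{supp}(\mu_X)$ and of full measure in it, i.e. $\mu_X(\operatorname{supp}(\mu_X)\setminus U)=0$, on which $f$ is locally constant (respectively continuous), meaning that the restriction $f|_U$ is so. The classes of such maps $X\to Y$ are denoted $Const_{ae}(X,Y)$ and $C_{ae}(X,Y)$. No measurability of $f$ is required. For maps $f:X\to Y$, $g:Y\to X$ let $R_{f,g}=\{(x,f(x)):x\in X\}\cup\{(g(y),y):y\in Y\}\subset X\times Y$, and for $\sigma\subset X\times Y$ let $\operatorname{dis}\sigma=\sup\{|d_X(a,a')-d_Y(b,b')|:(a,b),(a',b')\in\sigma\}$. The partially locally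 constant and the partially continuous Gromov--Hausdorff distances are $$d_{GH}^{aeconst}(X,Y)=\tfrac12\inf_{f\in Const_{ae}(X,Y),\ g\in Const_{ae}(Y,X)}\operatorname{dis}R_{f,g},\qquad d_{GH}^{aec}(X,Y)=\tfrac12\inf_{f\in C_{ae}(X,Y),\ g\in C_{ae}(Y,X)}\operatorname{dis}R_{f,g},$$ with the infimum over the empty set equal to $\infty$. *)

(* Defs.v *)
From HB Require Import structures.
From mathcomp Require Import all_boot all_order all_algebra.
From mathcomp Require Import all_classical all_reals all_analysis.

Set Implicit Arguments.
Unset Strict Implicit.
Unset Printing Implicit Defensive.

Import Order.TTheory GRing.Theory Num.Theory.

Local Open Scope classical_set_scope.
Local Open Scope ring_scope.
Local Open Scope ereal_scope.

(* Every [measurableType] is pointed, hence [{measure set T -> \bar R}] would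
   exclude the empty metric space. [is_measure_on G] spells out the axioms of a
   measure on the sigma-algebra <<s G >> for a possibly empty T; the values of
   mu outside <<s G >> are irrelevant. The next two lemmas show that, on a
   pointed type, this is the measure of the library. *)
Definition is_measure_on (R : realType) (T : Type) (G : set (set T))
    (mu : set T -> \bar R) : Prop :=
  [/\ mu set0 = 0,
      forall A, <<s G >> A -> 0 <= mu A
    & forall F : (set T)^nat, (forall i, <<s G >> (F i)) -> trivIset setT F ->
        (fun n => \sum_(0 <= i < n) mu (F i)) @ \oo --> mu (\bigcup_n F n)].

Lemma is_measure_on_measure (R : realType) (T : pointedType) (G : set (set T))
    (mu : {measure set (g_sigma_algebraType G) -> \bar R}) :
  is_measure_on G mu.
Proof.
split=> [|A _|F mF tF]; [exact: measure0|exact: measure_ge0|].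
by apply: measure_semi_sigma_additive => //; exact: bigcupT_measurable.
Qed.

Lemma measure_of_is_measure_on (R : realType) (T : pointedType)
    (G : set (set T)) (mu : set T -> \bar R) : is_measure_on G mu ->
  exists nu : {measure set (g_sigma_algebraType G) -> \bar R},
    forall A, <<s G >> A -> nu A = mu A.
Proof.
move=> [mu0 mu_ge0 mu_sadd].
pose nu (A : set (g_sigma_algebraType G)) := if `[< <<s G >> A >] then mu A else 0.
have nuE A : <<s G >> A -> nu A = mu A by move=> mA; rewrite /nu asboolT.
have nu0 : nu set0 = 0 by rewrite nuE//; exact: sigma_algebra0.
have nu_ge0 A : 0 <= nu A by rewrite /nu; case: asboolP => // /mu_ge0.
have nu_sadd : semi_sigma_additive nu.
  move=> F mF tF mUF; rewrite nuE//.
  have -> : (fun n => \sum_(0 <= i < n) nu (F i)) =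
            (fun n => \sum_(0 <= i < n) mu (F i)).
    by apply/funext => n; apply: eq_bigr => i _; rewrite nuE//; exact: mF.
  exact: mu_sadd.
pose m := isMeasure.Build _ (g_sigma_algebraType G) R nu nu0 nu_ge0 nu_sadd.
pose nu' : {measure set (g_sigma_algebraType G) -> \bar R} :=
  HB.pack nu m.
by exists nu'.
Qed.

Record gromov_triple (R : realType) := GromovTriple {
  gt_space :> metricType R ;
  gt_measure : set gt_space -> \bar R ;
  gt_measureP : is_measure_on (@open gt_space) gt_measure ;
  gt_boundedly_finite :
    forall (x : gt_space) (r : R), gt_measure (ball x r) < +oo }.

Section classical_distances.
Context {R : realType}.

Definition hausdorff_dist (Z : metricType R) (A B : set Z) : \bar R :=
  ereal_inf [set r%:E | r in [set r : R | [/\ (0 < r)%R,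
    A `<=` \bigcup_(b in B) ball b r & B `<=` \bigcup_(a in A) ball a r]]].

Definition isometric_embedding (X Z : metricType R) (i : X -> Z) : Prop :=
  forall x x', mdist (i x) (i x') = mdist x x'.

Definition GH_dist (X Y : metricType R) : \bar R :=
  ereal_inf [set e | exists (Z : metricType R) (i : X -> Z) (j : Y -> Z),
    [/\ isometric_embedding i, isometric_embedding j
      & e = hausdorff_dist (range i) (range j)]].

Definition graph_pair (X Y : metricType R) (f : X -> Y) (g : Y -> X) :
    set (X * Y) :=
  [set (x, f x) | x in setT] `|` [set (g y, y) | y in setT].

(* The supremum is taken in [0, +oo]: adding 0 only affects the distortion of
   the empty relation, which would otherwise be -oo. *)
Definition distortion (X Y : metricType R) (s : set (X * Y)) : \bar R :=
  ereal_sup (0 |` [set `|mdist p.1 q.1 - mdist p.2 q.2|%:E | p in s & q in s]).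

End classical_distances.

Section partial_distances.
Context {R : realType}.
Implicit Types X Y : gromov_triple R.

Definition msupport X : set X :=
  [set x | forall O : set X, open O -> O x -> 0 < gt_measure O].

Definition full_open_in_support X (U : set X) : Prop :=
  (exists2 O : set X, open O & U = O `&` @msupport X) /\
  gt_measure (@msupport X `\` U) = 0.

Definition locally_constant_on X Y (U : set X) (f : X -> Y) : Prop :=
  forall x, U x -> \forall x' \near x, U x' -> f x' = f x.

Definition Const_ae X Y : set (X -> Y) :=
  [set f | exists2 U : set X, full_open_in_support U & locally_constant_on U f].

Definition C_ae X Y : set (X -> Y) :=
  [set f | exists2 U : set X, full_open_in_support U & {within U, continuous f}].

Definition aeconst_GH_dist X Y : \bar R :=
  (2^-1)%:E * ereal_inf [set distortion (graph_pair f g) |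
                           f in @Const_ae X Y & g in @Const_ae Y X].

Definition aec_GH_dist X Y : \bar R :=
  (2^-1)%:E * ereal_inf [set distortion (graph_pair f g) |
                           f in @C_ae X Y & g in @C_ae Y X].

End partial_distances.

(* Main.v *)
Require Import Defs.
From HB Require Import structures.
From mathcomp Require Import all_boot all_order all_algebra.
From mathcomp Require Import all_classical all_reals all_analysis.
From mathcomp Require Import lra.

(** Every locally constant map is continuous, so d^aec <= d^aeconst, and the
classical estimate d_GH <= 1/2 dis R_{f,g} holds for arbitrary maps f and g, so
d_GH <= d^aec. The content of the theorem is d^aeconst <= d_GH.

For that, suppose that X and Y sit in a common metric space Z at Hausdorff
distance less than r. Choosing nearby points gives arbitrary maps
phi : X -> Y and psi : Y -> X that move points by less than r in Z. It is
enough to make them a.e. locally constant at the cost of an arbitrarily small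
e > 0, and this is done by precomposition: [ae_locally_constant_approx] gives
h : X -> X moving points by less than e and locally constant on a relatively
open subset of full measure of the support, and phi \o h moves points by less
than r + e in Z. Hence dis R_{phi \o h, psi \o k} <= 2 (r + e).

The map h comes from a partition of the support, up to a null set, into
countably many small open cells. There are two countability arguments, both
instances of [Borel_countable]: a disjoint family of Borel sets has only
countably many members of positive measure. Applied to a maximal disjoint
family of balls centred in the support, it shows that the support is separable
([msupport_dense_sequence]). Applied to the spheres around a point, it shows
that radii with a null sphere are dense ([null_sphere_radius]). Covering the
support by balls with null boundary spheres and removing from each ball the
previous closed balls gives the cells; what is left of the support lies on the
countably many null spheres. On each cell h takes the centre of the ball as
its value, and off the cells it is the identity.

The estimate d_GH <= 1/2 dis R_{f,g} is proved by gluing X and Y along the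
relation R_{f,g} ([glue_metric]). *)

Set Implicit Arguments.
Unset Strict Implicit.
Unset Printing Implicit Defensive.

Import Order.TTheory GRing.Theory Num.Theory.

Local Open Scope classical_set_scope.
Local Open Scope ring_scope.

(** * Null sets and disjoint families *)

Lemma is_measure_on_bigcup_null (R : realType) (T : Type) (G : set (set T))
    (mu : set T -> \bar R) (F : (set T)^nat) (N : set T) :
  is_measure_on G mu ->
  (forall n, <<s G >> (F n)) -> (forall n, mu (F n) = 0%E) ->
  <<s G >> N -> N `<=` \bigcup_n F n -> mu N = 0%E.
Proof.
elim/Ppointed: T => S in G mu F N *.
  by move=> [mu0 _ _] *; rewrite [N]emptyE.
move=> /measure_of_is_measure_on[nu nuE] mF F0 mN NF.
apply/eqP; rewrite eq_le -nuE// measure_ge0 andbT.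
rewrite (le_trans (measure_sigma_subadditive nu mF mN NF))//.
by rewrite eseries0// => i _ _; rewrite nuE.
Qed.

(** By sigma-finiteness a set of positive measure has a trace of measure more
than some 1/(k+1) on some member of the cover, and disjointness bounds the
number of such traces inside a set of finite measure. *)
Lemma is_measure_on_countable (R : realType) (T : Type) (G : set (set T))
    (mu : set T -> \bar R) (I : Type) (D : set I) (A : I -> set T)
    (B : (set T)^nat) :
  is_measure_on G mu ->
  (forall n, <<s G >> (B n)) -> (forall n, (mu (B n) < +oo)%E) ->
  \bigcup_n B n = setT ->
  (forall i, D i -> <<s G >> (A i)) -> trivIset D A ->
  countable [set i | D i /\ (0 < mu (A i))%E].
Proof.
elim/Ppointed: I => I in D A *; first by rewrite emptyE.
elim/Ppointed: T => S in G mu A B *.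
  move=> [mu0 _ _] *; rewrite (_ : [set i | _] = set0)//.
  by apply/seteqP; split => // i [_]; rewrite [A i]emptyE mu0 ltxx.
move=> /measure_of_is_measure_on[nu nuE] mB Bfin BT mA tA.
have mAB n i : D i -> <<s G >> (A i `&` B n).
  move=> Di.
  exact: (@measurableI _ (g_sigma_algebraType G) _ _ (mA i Di) (mB n)).
apply: (@sub_countable _ _ _ (\bigcup_n \bigcup_k
    [set i | D i /\ (k.+1%:R^-1%:E < nu (A i `&` B n))%E])).
  apply: subset_card_le => i [Di Ai0]; apply: contrapT => ABi.
  have AB0 n : nu (A i `&` B n) = 0%E.
    apply/eqP; rewrite eq_le measure_ge0 andbT; apply/lee_addgt0Pr => e e0.
    rewrite add0e leNgt; apply/negP => eAB; apply: ABi.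
    have /ltr_add_invr[k] := e0; rewrite add0r => ke.
    exists n => //; exists k => //; split=> //.
    by rewrite (lt_trans _ eAB)// lte_fin.
  move: Ai0; rewrite -nuE; last exact: mA.
  have ABU : A i `<=` \bigcup_n (A i `&` B n) by rewrite -setI_bigcupr BT setIT.
  have /(_ nu) := @measure_sigma_subadditive _ R (g_sigma_algebraType G) _ _ _
    (fun n => mAB n i Di) (mA i Di) ABU.
  by rewrite eseries0// leNgt => /negP.
apply: bigcup_countable => // n _; apply: bigcup_countable => // k _.
apply: finite_set_countable; apply: contrapT.
move=> /infiniteP/pcard_leP/injfunPex[/= q q_fun q_inj].
have I0 j : [set: nat] j by [].
have nuBfin : nu (B n) \is a fin_num.
  by rewrite ge0_fin_numE// nuE.
(* N terms larger than 1/(k+1) already add up to more than nu (B n). *)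
pose N := (Num.truncn (k.+1%:R * fine (nu (B n)))).+1.
have: (nu (\bigcup_j (A (q j) `&` B n)) <= nu (B n))%E.
  apply: le_measure.
  - rewrite inE; apply: bigcupT_measurable => j; apply: mAB.
    by case: (q_fun j (I0 j)).
  - by rewrite inE; exact: mB.
  - by move=> x [j _ []].
rewrite measure_bigcup//=; last first.
- apply/trivIsetP => i j _ _ ij.
  have [[Dqi _] [Dqj _]] := (q_fun i (I0 i), q_fun j (I0 j)).
  have /trivIsetP/(_ _ _ Dqi Dqj) Aij := tA.
  rewrite setIACA setIid Aij ?set0I//.
  apply: contra_neq ij => qij; exact: q_inj (in_setT _) (in_setT _) qij.
- by move=> j _; apply: mAB; case: (q_fun j (I0 j)).
rewrite leNgt => /negP; apply.
apply: (lt_le_trans _ (nneseries_lim_ge N _)) => //.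
apply: (@lt_le_trans _ _ (\sum_(0 <= j < N) k.+1%:R^-1%:E)%E).
  rewrite -(fineK nuBfin) sumEFin lte_fin sumr_const_nat subn0.
  rewrite -[ltRHS]mulr_natl.
  rewrite ltr_pdivlMr// mulrC.
  exact: truncnS_gt.
rewrite [leRHS]big_mkcond/=; apply: lee_sum => j _.
by rewrite in_setT ltW//; case: (q_fun j (I0 j)).
Qed.

(** * Balls, spheres and the support *)

Lemma open_mdist_lt (R : realType) (T : metricType R) (c : T) (r : R) :
  open [set x | mdist c x < r].
Proof.
rewrite openE => x /= cxr; apply/nbhs_ballP.
exists (r - mdist c x) => /=; first by rewrite subr_gt0.
move=> y; rewrite ballEmdist/= ltrBrDl; apply: le_lt_trans.
exact: metric_triangle.
Qed.

Lemma open_mdist_gt (R : realType) (T : metricType R) (c : T) (r : R) :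
  open [set x | r < mdist c x].
Proof.
rewrite openE => x /= cxr; apply/nbhs_ballP.
exists (mdist c x - r) => /=; first by rewrite subr_gt0.
move=> y; rewrite ballEmdist/= ltrBrDl -ltrBrDr => /lt_le_trans; apply.
by rewrite lerBlDr (metric_sym x); exact: metric_triangle.
Qed.

Section triples.
Context {R : realType}.
Implicit Types X : gromov_triple R.

Definition Borel X : set (set X) := <<s @open X >>.

Lemma Borel_open X (A : set X) : open A -> Borel A.
Proof. exact: sub_sigma_algebra. Qed.

Lemma Borel_setC X (A : set X) : Borel A -> Borel (~` A).
Proof. by rewrite -setTD; exact: sigma_algebraCD. Qed.

Lemma Borel_closed X (A : set X) : closed A -> Borel A.
Proof.
by move=> cA; rewrite -(setCK A); apply: Borel_setC; apply: Borel_open;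
  exact: closed_openC.
Qed.

Lemma Borel_sphere X (c : X) (r : R) : Borel [set x | mdist c x = r].
Proof.
apply: Borel_closed.
rewrite (_ : [set x | _] =
    ~` ([set x | mdist c x < r] `|` [set x | r < mdist c x])).
  by apply/open_closedC/openU; [exact: open_mdist_lt|exact: open_mdist_gt].
apply/seteqP; split=> x /=; first by move=> ->; rewrite ltxx; case.
by move=> /not_orP[/negP + /negP]; rewrite -!leNgt => *; apply/le_anti/andP.
Qed.

Lemma closed_msupport X : closed (@msupport R X).
Proof.
rewrite -(setCK (@msupport R X)); apply: open_closedC.
rewrite openE => x /existsNP[V /not_implyP[oV /not_implyP[Vx V0]]].
apply: filterS (open_nbhs_nbhs (conj oV Vx)) => y Vy yS.
exact/V0/yS.
Qed.

Lemma Borel_countable X (I : Type) (D : set I) (A : I -> set X) :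
  (forall i, D i -> Borel (A i)) -> trivIset D A ->
  countable [set i | D i /\ (0 < gt_measure (A i))%E].
Proof.
move=> mA tA.
have [[x0]|noX] := pselect (inhabited X); last first.
  rewrite (_ : [set i | _] = set0)//; apply/seteqP; split => // i [_].
  rewrite (_ : A i = set0); last by apply/seteqP; split => // x; case: noX.
  by have [-> _ _] := gt_measureP X; rewrite ltxx.
apply: (is_measure_on_countable (gt_measureP X)
  (B := fun n : nat => ball x0 n.+1%:R)) => //.
- move=> n; apply: Borel_open; rewrite ballEmdist; exact: open_mdist_lt.
- by move=> n; exact: gt_boundedly_finite.
- apply/seteqP; split => // x _; exists (Num.truncn (mdist x0 x)) => //.
  by rewrite ballEmdist/=; exact: truncnS_gt.
Qed.

(** Distinct radii give disjoint spheres, so only countably many of them are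
charged, whereas an interval is uncountable. *)
Lemma null_sphere_radius X (c : X) (a b : R) : a < b ->
  exists2 r, a < r < b & gt_measure [set x | mdist c x = r] = 0%E.
Proof.
move=> ab; apply: contrapT => nor.
pose S r := [set x : X | mdist c x = r].
have: countable [set r | `]a, b[%classic r /\ (0 < gt_measure (S r))%E].
  apply: Borel_countable => [r _|]; first exact: Borel_sphere.
  by apply/trivIsetP => i j _ _ /eqP ij; apply/seteqP; split => // x [/= xi xj];
    case: ij; rewrite -xi -xj.
rewrite (_ : [set r | _] = `]a, b[%classic); last first.
  apply/seteqP; split => [r []//|r /= rab]; split => //.
  have [_ + _] := gt_measureP X.
  move=> /(_ _ (Borel_sphere c r)); rewrite le_eqVlt => /predU1P[r0|//].
  by case: nor; exists r => //; move: rab; rewrite in_itv.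
move=> /countable_lebesgue_measure0; rewrite lebesgue_measure_itv/= lte_fin ab.
rewrite -EFinB => -[/eqP]; rewrite subr_eq0 => /eqP ba.
by rewrite ba ltxx in ab.
Qed.

(** The metric space X need not be separable, but the support is: disjoint open
balls centred in it have positive measure, so there are only countably many of
them, and the centres of a maximal such family of radius e/2 are e-dense in
the support. *)
Lemma msupport_dense_sequence X (x0 : X) (e : R) : 0 < e ->
  exists q : nat -> X, forall x, msupport x -> exists n, mdist (q n) x < e.
Proof.
move=> e0; pose B c : set X := [set x | mdist c x < e / 2].
have [D [DS tD maxD]] := ex_maximal_disjoint_subcollection B (@msupport R X).
have BB c : B c c by rewrite /B/= mdistxx divr_gt0.
have cD : countable D.
  have mB c : D c -> Borel (B c).
    by move=> _; exact: Borel_open (open_mdist_lt _ _).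
  apply: sub_countable (Borel_countable mB tD).
  apply: subset_card_le => c Dc; split => //; apply: (DS _ Dc) (BB c).
  exact: open_mdist_lt.
have [q Dq] : exists q : nat -> X, D `<=` range q.
  have /pfcard_geP[D0|[g]] := cD; first by exists (cst x0); rewrite D0.
  exists g; exact: surj.
exists q => x Sx; suff [c Dc cx] : exists2 c, D c & mdist c x < e.
  by have [n _ nc] := Dq _ Dc; exists n; rewrite nc.
apply: contrapT => /forall2NP far.
have nDx : ~ D x by move=> Dx; case: (far x) => //; rewrite mdistxx.
have farB c : D c -> B c `&` B x = set0.
  move=> Dc; apply/seteqP; split => // z [/= cz xz]; case: (far c) => //; apply.
  rewrite (le_lt_trans (metric_triangle _ z _))// (splitr e) ltrD//.
  by rewrite metric_sym.
apply: (maxD (x |` D)).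
- by split; [move=> c; right|move=> /(_ x (or_introl erefl))].
- by move=> c [->|/DS].
apply/trivIsetP => i j [->|Di] [->|Dj] ij.
- by rewrite eqxx in ij.
- by rewrite setIC farB.
- by rewrite farB.
- by move/trivIsetP : tD; exact.
Qed.

(** The identity is a uniform limit of a.e. locally constant maps. *)
Lemma ae_locally_constant_approx X (e : R) : 0 < e ->
  exists (h : X -> X) (U : set X),
    [/\ full_open_in_support U, locally_constant_on (Y := X) U h
      & forall x, mdist x (h x) < e].
Proof.
move=> e0; have [mu0 _ _] := gt_measureP X.
have [[x0]|noX] := pselect (inhabited X); last first.
  have X0 (A : set X) : A = set0 by apply/seteqP; split => // x; case: noX.
  exists id, set0; split=> [|//|x]; last by case: noX.
  by split; [exists set0; [exact: open0|rewrite set0I]|rewrite (X0 (_ `\` _))].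
(* Centres e/2-dense and radii between e/2 and e: the open balls cover the
   support. *)
have [q qP] := msupport_dense_sequence x0 (divr_gt0 e0 (ltr0n _ 2)).
have /choice[r rP] n : exists r, [/\ e / 2 < r, r < e
    & gt_measure [set x | mdist (q n) x = r] = 0%E].
  have e2e : e / 2 < e by rewrite ltr_pdivrMr// ltr_pMr// ltr1n.
  have [r /andP[er re] r0] := null_sphere_radius (q n) e2e.
  by exists r.
(* The n-th ball minus the previous closed balls, these being written as
   complements of open sets to make the openness of the cell visible. *)
pose cell n : set X := [set x | mdist (q n) x < r n] `&`
  ~` \bigcup_(j in `I_n) ~` [set x | r j < mdist (q j) x].
have cellP n x : cell n x <->
    mdist (q n) x < r n /\ forall j, (j < n)%N -> r j < mdist (q j) x.
  split=> -[xn far]; split=> //.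
  - by move=> j jn; apply: contrapT => jx; apply: far; exists j.
  - by move=> -[j /= jn]; apply; exact: far.
have cell_open n : open (cell n).
  apply: openI; first exact: open_mdist_lt.
  apply/closed_openC/closed_bigcup => // j _; apply/open_closedC.
  exact: open_mdist_gt.
have cell_disj m n x : cell m x -> cell n x -> m = n.
  move=> /cellP[mx mfar] /cellP[nx nfar]; apply/eqP; rewrite eqn_leq.
  by apply/andP; split; rewrite leqNgt; apply/negP;
    [move=> /mfar|move=> /nfar]; rewrite ltNge ltW.
have /choice[h hP] x :
    exists y, (forall n, cell n x -> y = q n) /\ mdist x y < e.
  have [[n nx]|nocell] := pselect (exists n, cell n x).
    exists (q n); split=> [m mx|]; first by rewrite (cell_disj _ _ _ mx nx).
    have /cellP[qnx _] := nx; rewrite metric_sym (lt_trans qnx)//.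
    by have [] := rP n.
  exists x; split=> [n nx|]; last by rewrite mdistxx.
  by case: nocell; exists n.
pose O := \bigcup_n cell n.
have oO : open O by exact: bigcup_open.
exists h, (O `&` @msupport R X); split; last by move=> x; have [] := hP x.
- split; first by exists O.
  apply: (@is_measure_on_bigcup_null R X _ _
    (fun n => [set x | mdist (q n) x = r n]) _ (gt_measureP X)).
  + by move=> n; exact: Borel_sphere.
  + by move=> n; have [] := rP n.
  + rewrite setDE setCI setIUr setICr setU0; apply: Borel_closed.
    by apply: closedI; [exact: closed_msupport|exact: open_closedC].
  + move=> x [Sx nOx]; have nx : exists n, mdist (q n) x <= r n.
      have [n xn] := qP x Sx; exists n; rewrite ltW// (lt_trans xn)//.
      by have [] := rP n.
    (* The first closed ball containing x contains it on its boundary sphere,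
       for otherwise x would be in the corresponding cell. *)
    case: (ex_minnP nx) => n qnx nmin; exists n => //=; apply/eqP.
    rewrite eq_le qnx leNgt; apply/negP => xn; apply: nOx; split => //.
    exists n => //; apply/cellP; split => // j jn.
    by rewrite ltNge; apply/negP => /nmin; rewrite leqNgt jn.
- move=> x [[n _ nx] _].
  apply: filterS (open_nbhs_nbhs (conj (cell_open n) nx)) => y ny _.
  by have [[hx _] [hy _]] := (hP x, hP y); rewrite (hx n) // (hy n).
Qed.
End triples.

(** * Gluing two metric spaces along a relation *)

Section gluing.
Context {R : realType} {X Y : metricType R}.
Variables (s : set (X * Y)) (delta : R).
Hypothesis delta0 : 0 < delta.
Hypothesis s_dis : forall p q, s p -> s q ->
  `|mdist p.1 q.1 - mdist p.2 q.2| <= delta *+ 2.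
Hypothesis s_total : forall x, exists y, s (x, y).

(** Lengths of the paths from x to y through a bridge of length delta joining
two related points. *)
Let bridge x y := [set mdist x p.1 + delta + mdist p.2 y | p in s].

Let cross x y : R := inf (bridge x y).

Let bridge_neq0 x y : bridge x y !=set0.
Proof.
have [y' sxy'] := s_total x.
by exists (mdist x x + delta + mdist y' y), (x, y').
Qed.

Let bridge_lb x y : lbound (bridge x y) delta.
Proof.
move=> _ [p _ <-]; rewrite -addrA addrCA lerDl addr_ge0//; exact: mdist_ge0.
Qed.

Let cross_ge x y : delta <= cross x y.
Proof. by apply: lb_le_inf. Qed.

Let cross_le x y p : s p -> cross x y <= mdist x p.1 + delta + mdist p.2 y.
Proof.
by move=> sp; apply: ge_inf; [exists delta; exact: bridge_lb|exists p].
Qed.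

Let le_cross x y c :
  (forall p, s p -> c <= mdist x p.1 + delta + mdist p.2 y) -> c <= cross x y.
Proof. by move=> H; apply: lb_le_inf => // _ [p sp <-]; exact: H. Qed.

Definition glue_dist (u v : X + Y) : R :=
  match u, v with
  | inl x, inl x' => mdist x x'
  | inr y, inr y' => mdist y y'
  | inl x, inr y | inr y, inl x => cross x y
  end.

Let glue_distxx u : glue_dist u u = 0.
Proof. by case: u => z /=; rewrite mdistxx. Qed.

Let glue_dist_positivity u v : glue_dist u v = 0 -> u = v.
Proof.
case: u v => [x|y] [x'|y'] /=; do ?by move=> /mdist_positivity ->.
- by move=> h; have := cross_ge x y'; rewrite h leNgt delta0.
- by move=> h; have := cross_ge x' y; rewrite h leNgt delta0.
Qed.

Let glue_dist_sym u v : glue_dist u v = glue_dist v u.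
Proof. by case: u v => [x|y] [x'|y'] //=; rewrite metric_sym. Qed.

Let glue_dist_triangle v u w : glue_dist u w <= glue_dist u v + glue_dist v w.
Proof.
have triX := @metric_triangle R X; have triY := @metric_triangle R Y.
have symX := @metric_sym R X; have symY := @metric_sym R Y.
have crossX x x' y : cross x y <= mdist x x' + cross x' y.
  rewrite -lerBlDl; apply: le_cross => p sp.
  have := cross_le x y sp; have := triX x x' p.1; lra.
have crossY x y y' : cross x y <= cross x y' + mdist y' y.
  rewrite -lerBlDr; apply: le_cross => p sp.
  have := cross_le x y sp; have := triY p.2 y' y; lra.
(* A path from X to X through y crosses two bridges p and q, of total length
   2 delta, which pays for replacing the jump from p.2 to q.2 by the one from
   p.1 to q.1. *)
have overY x x' y : mdist x x' <= cross x y + cross x' y.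
  rewrite -lerBlDr; apply: le_cross => p sp.
  rewrite lerBlDr -lerBlDl; apply: le_cross => q sq.
  have := s_dis sp sq; rewrite ler_norml => /andP[_].
  have := triX x p.1 x'; have := triX p.1 q.1 x'; have := triY p.2 y q.2.
  have := symX x' q.1; have := symY y q.2; lra.
have overX y y' x : mdist y y' <= cross x y + cross x y'.
  rewrite -lerBlDr; apply: le_cross => p sp.
  rewrite lerBlDr -lerBlDl; apply: le_cross => q sq.
  have := s_dis sp sq; rewrite ler_norml => /andP[+ _].
  have := triY y p.2 y'; have := triY p.2 q.2 y'; have := triX p.1 x q.1.
  have := symX x p.1; have := symY y p.2; lra.
case: u v w => [x|y] [x'|y'] [x''|y''] //=.
- by rewrite addrC symX; exact: crossX.
- by rewrite addrC symY; exact: crossY.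
Qed.

(** The bridge has length delta >= 1/2 dis s, so a path crossing it twice is
never a shortcut and both spaces keep their metric; delta > 0 separates the
points of X from those of Y. *)
Lemma glue_metric : exists (Z : metricType R) (i : X -> Z) (j : Y -> Z),
  [/\ isometric_embedding i, isometric_embedding j
    & forall x y, s (x, y) -> mdist (i x) (j y) <= delta].
Proof.
pose m := isMetric.Build R (X + Y)%type glue_distxx glue_dist_positivity
  glue_dist_sym glue_dist_triangle.
pose Z : metricType R := HB.pack (X + Y)%type m.
exists Z, inl, inr; split=> // x y sxy.
by have := cross_le x y sxy; rewrite /= !mdistxx add0r addr0.
Qed.

End gluing.

(** The points x and f x, and y and g y, are at distance at most delta in the
glued space, so the Hausdorff distance of X and Y is at most delta there. *)
Lemma GH_dist_le_distortion (R : realType) (X Y : metricType R) (f : X -> Y)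
    (g : Y -> X) :
  (GH_dist X Y <= 2^-1%:E * distortion (graph_pair f g))%E.
Proof.
set s := graph_pair f g.
have dis_ge0 : (0 <= distortion s)%E by apply: ereal_sup_ubound; left.
have [->|disoo] := eqVneq (distortion s) +oo%E.
  by rewrite gt0_muley ?leey// lte_fin invr_gt0.
have dfin : distortion s \is a fin_num by rewrite ge0_fin_numE// ltey.
apply/lee_addgt0Pr => e e0.
(* The term e/2 makes delta positive even when the distortion vanishes. *)
pose delta := 2^-1 * fine (distortion s) + e / 2.
have delta0 : 0 < delta.
  by rewrite ltr_wpDl ?divr_gt0// mulr_ge0// fine_ge0.
have [p q sp sq|x|Z [i [j [iP jP ijP]]]] := @glue_metric R X Y s delta delta0.
- rewrite -lee_fin; apply: (@le_trans _ _ (distortion s)).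
    by apply: ereal_sup_ubound; right; exists p => //; exists q.
  rewrite -(fineK dfin) lee_fin /delta -mulr_natr; lra.
- by exists (f x); left; exists x.
apply: ge_ereal_inf; exists (hausdorff_dist (range i) (range j)).
  by exists Z, i, j.
apply: ge_ereal_inf; exists (delta + e / 2)%:E; last first.
  by rewrite -(fineK dfin) -EFinM -EFinD lee_fin /delta; lra.
have lt : delta < delta + e / 2 by rewrite ltrDl divr_gt0.
exists (delta + e / 2) => //; split; first exact: lt_trans delta0 lt.
- move=> _ [x _ <-]; exists (j (f x)); first by exists (f x).
  rewrite ballEmdist/= metric_sym (le_lt_trans _ lt)//; apply: ijP.
  by left; exists x.
- move=> _ [y _ <-]; exists (i (g y)); first by exists (g y).
  rewrite ballEmdist/= (le_lt_trans _ lt)//; apply: ijP.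
  by right; exists y.
Qed.

(** * Comparison of the distances *)

(** Nearby points in a common ambient space give maps of small distortion, and
[ae_locally_constant_approx] makes them a.e. locally constant. *)
Lemma aeconst_GH_dist_le_GH_dist (R : realType) (X Y : gromov_triple R) :
  (aeconst_GH_dist X Y <= GH_dist X Y)%E.
Proof.
apply/ereal_infP => _ [Z [i [j [iP jP ->]]]].
apply/ereal_infP => _ [r [r0 XY YX] <-].
apply/lee_addgt0Pr => e e0.
(* It remains to reach r + e for every e > 0. *)
have /choice[phi phiP] x : exists y, mdist (i x) (j y) < r.
  have [_ [y _ <-]] := XY _ (imageT i x).
  by rewrite ballEmdist/= metric_sym; exists y.
have /choice[psi psiP] y : exists x, mdist (i x) (j y) < r.
  have [_ [x _ <-]] := YX _ (imageT j y).
  by rewrite ballEmdist/=; exists x.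
have [h [U [Ufull hU hP]]] := @ae_locally_constant_approx _ X e e0.
have [k [V [Vfull kV kP]]] := @ae_locally_constant_approx _ Y e e0.
rewrite /aeconst_GH_dist -lee_pdivlMl; last by rewrite invr_gt0.
rewrite invrK; apply: ge_ereal_inf.
exists (distortion (graph_pair (phi \o h) (psi \o k))).
  exists (phi \o h).
    by exists U => // x /hU; apply: filterS => x' /[apply] /= ->.
  exists (psi \o k) => //.
  by exists V => // y /kV; apply: filterS => y' /[apply] /= ->.
have close p : graph_pair (phi \o h) (psi \o k) p ->
    mdist (i p.1) (j p.2) < r + e.
  case=> -[z _ <-] /=.
  - rewrite (le_lt_trans (metric_triangle _ (i (h z)) _))// addrC ltrD//.
    by rewrite iP.
  - rewrite (le_lt_trans (metric_triangle _ (j (k z)) _))// ltrD//.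
    by rewrite jP metric_sym.
rewrite -EFinD -EFinM; apply/ereal_supP => _ [->|[p sp [q sq <-]]].
  by rewrite lee_fin mulr_ge0// addr_ge0// ltW.
rewrite lee_fin -(iP p.1) -(jP p.2) ler_norml.
have := close p sp; have := close q sq.
have := metric_triangle (i p.1) (j p.2) (i q.1).
have := metric_triangle (j p.2) (j q.2) (i q.1).
have := metric_triangle (j p.2) (i p.1) (j q.2).
have := metric_triangle (i p.1) (i q.1) (j q.2).
have := metric_sym (i p.1) (j p.2); have := metric_sym (i q.1) (j q.2).
move=> *; apply/andP; split; lra.
Qed.

Lemma Const_ae_sub_C_ae (R : realType) (X Y : gromov_triple R) :
  @Const_ae R X Y `<=` @C_ae R X Y.
Proof.
move=> f [U Ufull fU]; exists U => //; apply/subspace_continuousP => x Ux.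
move=> V /nbhs_singleton Vfx; rewrite /= nbhs_simpl /within/=.
by apply: filterS (fU x Ux) => x' fx' Ux'; rewrite /= /from_subspace/= fx'.
Qed.

Theorem theorem5p3 (R : realType) (X Y : gromov_triple R) :
  aec_GH_dist X Y = aeconst_GH_dist X Y /\ aeconst_GH_dist X Y = GH_dist X Y.
Proof.
have aec_le_aeconst : (aec_GH_dist X Y <= aeconst_GH_dist X Y)%E.
  apply: lee_wpmul2l; first by rewrite lee_fin invr_ge0.
  apply: ereal_inf_le_tmp => _ [f fX [g gY <-]].
  by exists f; [exact: Const_ae_sub_C_ae|exists g; [exact: Const_ae_sub_C_ae|]].
have GH_le_aec : (GH_dist X Y <= aec_GH_dist X Y)%E.
  rewrite /aec_GH_dist -ereal_inf_pZl ?invr_gt0//.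
  by apply/ereal_infP => _ [_ [f _ [g _ <-]] <-]; exact: GH_dist_le_distortion.
have aeconst_le_GH := aeconst_GH_dist_le_GH_dist X Y.
split; apply/le_anti/andP; split=> //.
- exact: le_trans aeconst_le_GH GH_le_aec.
- exact: le_trans GH_le_aec aec_le_aeconst.
Qed.
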